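(* Let $n$ be a positive integer and let $\{\kappa_i:1\leq i\leq n-1\}$ be an increasing sequence of measurable cardinals. Then for each sequence $\{m_i:i\in n\}$ of positive integers there exists a Hausdorff space $X$ such that the lattice $\mathbf{OF}(X)$ is order isomorphic to $\prod_{i\in n}m_i$.
   Context: All topological spaces are assumed to be Hausdorff and infinite. Each natural number $m$ is identified with the set $\{0,\ldots,m-1\}$, regarded as a chain with its usual order, and $\prod_{i\in n}m_i$ carries the coordinatewise order. ''Increasing'' means strictly increasing. Filters are proper. A filter $\mathcal F$ on a space $X$ is open if it has a base consisting of open sets, and free if every $x\in X$ has an open neighborhood $U$ with $X\setminus U\in\mathcal F$. $\mathbf{OF}(X)$ is the poset of all free open filters on $X$, ordered by inclusion. A filter is $\kappa$-complete if it is closed under intersections of fewer than $\kappa$ of its elements. An uncountable cardinal $\kappa$ is measurable if it possesses a nonprincipal $\kappa$-complete ultrafilter. *)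

(* Defs.v *)
From mathcomp Require Import all_boot all_classical topology.

Set Implicit Arguments.
Unset Strict Implicit.
Unset Printing Implicit Defensive.

Local Open Scope classical_set_scope.
Local Open Scope card_scope.

Definition card_lt (T U : Type) (A : set T) (B : set U) : Prop :=
  A #<= B /\ A #!= B.

(* A cardinal is represented by a type of that cardinality. The family [G] may
   be empty: its intersection is then the whole of [T]. *)
Definition cardinal_complete (K T : Type) (F : set_system T) : Prop :=
  forall G : set_system T, G `<=` F -> card_lt G [set: K] ->
    F (\bigcap_(A in G) A).

Definition measurable_cardinal (K : Type) : Prop :=
  ~ countable [set: K] /\
  exists F : set_system K,
    [/\ UltraFilter F,
        forall x : K, F <> principal_filter x
      & cardinal_complete K F].

Definition open_filter (X : topologicalType) (F : set_system X) : Prop :=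
  forall A : set X, F A -> exists U : set X, [/\ open U, F U & U `<=` A].

Definition free_filter (X : topologicalType) (F : set_system X) : Prop :=
  forall x : X, exists U : set X, [/\ open U, U x & F (~` U)].

Definition OF (X : topologicalType) : Type :=
  {F : set_system X | [/\ ProperFilter F, open_filter F & free_filter F]}.

Definition OF_le (X : topologicalType) (F G : OF X) : Prop :=
  sval F `<=` sval G.

Definition chain_prod (n : nat) (m : 'I_n -> nat) : Type :=
  forall i : 'I_n, 'I_(m i).

Definition chain_prod_le (n : nat) (m : 'I_n -> nat) (x y : chain_prod m) :
    Prop :=
  forall i : 'I_n, (x i <= y i)%N.

Definition order_isomorphic (A B : Type) (leA : A -> A -> Prop)
    (leB : B -> B -> Prop) : Prop :=
  exists f : A -> B, bijective f /\ forall x y : A, leA x y <-> leB (f x) (f y).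

(* Main.v *)
Require Import Defs.
From HB Require Import structures.
From mathcomp Require Import all_boot all_classical topology.

Set Implicit Arguments.
Unset Strict Implicit.
Unset Printing Implicit Defensive.

Local Open Scope classical_set_scope.

(* Let p_0 be a free ultrafilter on nat and p_i a free kappa_i-complete
   ultrafilter on kappa_i. By completeness, "for p_i-almost all s, for
   p_j-almost all t" commutes for i <> j, hence the product ultrafilter u of
   m_i factors p_i (for all i < n) does not depend on their order. For
   1 <= j < m_i, take the ultrafilter p_i^j as a level above u: a node x in
   kappa_i^j has as neighborhoods the sets containing almost all extensions of x
   on the later levels of chain i and on the top level carrying u. Because p_i
   can be moved to the front of u, an open set that is large on one level is
   large on all later ones, and these form n disjoint chains of length m_i - 1
   with u as common end. Hence the open filters that trace the prescribed
   ultrafilter, or nothing, on each level and that trace u on the top correspond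
   to the choice of a final segment in each chain, that is, to the product of
   the m_i.

   To make these the only free open filters, adjoin a second, discrete copy of
   the space and a point y for each free ultrafilter y on it. The new points
   take care of all filters meeting the copy, and by letting y also be a limit
   of the ultrafilter y on the isolated points of the original space, except
   for y = u and convergent y, they absorb every unwanted filter there. *)

(** * Preliminaries on ultrafilters *)

Lemma ultra_of_setVsetC (T : Type) (F : set_system T) :
  ProperFilter F -> (forall A, F A \/ F (~` A)) -> UltraFilter F.
Proof.
move=> FF dich; split=> // G GF sFG; apply/seteqP; split=> // A GA.
have [//|/sFG GnA] := dich A.
by case: (@filter_not_empty _ G GF); rewrite -(setICr A); exact: filterI.
Qed.

Lemma ultra_setC (T : Type) (F : set_system T) (A : set T) :
  UltraFilter F -> ~ F A -> F (~` A).
Proof. by move=> FU nFA; case: (in_ultra_setVsetC A FU). Qed.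

Lemma filter_setC (T : Type) (F : set_system T) (A : set T) :
  ProperFilter F -> F A -> ~ F (~` A).
Proof.
move=> FF FA FnA; apply: (@filter_not_empty _ F FF).
by rewrite -(setICr A); exact: filterI.
Qed.

Lemma ultra_neq (T : Type) (F G : set_system T) :
  UltraFilter F -> UltraFilter G -> F <> G -> exists2 A, F A & G (~` A).
Proof.
move=> FU GU FG; apply: contrapT => nA; apply/FG/esym.
apply: (@max_filter _ F FU G (@ultra_proper _ G GU)) => A FA.
by apply: contrapT => /ultra_setC GA; apply: nA; exists A.
Qed.

Lemma ultra_extension (T : Type) (F : set_system T) (B : set T) :
  Filter F -> ~ F (~` B) -> exists G, [/\ UltraFilter G, F `<=` G & G B].
Proof.
move=> FF nFB.
have WF : ProperFilter (within B F).
  apply: Build_ProperFilter_ex => P FP; apply: contrapT => nP; apply: nFB.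
  by apply: (filterS _ FP) => x Px; apply: nP; exists x.
have [G [GU sG]] := ultraFilterLemma WF.
exists G; split=> // [A FA|]; apply: sG.
  by rewrite /within /=; apply: filterS FA => x.
by rewrite /within /=; apply: filterE.
Qed.

Lemma ultra_inverse_image (S S' : Type) (f : S -> S') (F : set_system S') :
  injective f -> UltraFilter F -> F (range f) ->
  UltraFilter [set A | F (f @` A)].
Proof.
move=> finj FU Ff; apply: ultra_of_setVsetC.
  split; first by rewrite /= image_set0; exact: filter_not_empty.
  split=> /= [//|A B /= FA FB|A B AB /=].
    apply: filterS2 FA FB => _ [x Ax <-] [x' Bx' /finj xx'].
    by rewrite {}xx' in Bx'; exists x.
  by apply: filterS => _ [x /AB Bx <-]; exists x.
move=> A; have [FA|FA] := in_ultra_setVsetC (f @` A) FU; [by left|right].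
by apply: filterS2 Ff FA => _ [x _ <-] nA; exists x => // Ax; apply: nA; exists x.
Qed.

(** * Iterated products of commuting ultrafilters *)

Section IteratedUltrafilters.
Variables (I : finType) (T : Type) (p : I -> set_system T).
Hypothesis p_ultra : forall i, UltraFilter (p i).
Hypothesis p_free : forall i t, ~ p i [set t].
Hypothesis p_comm : forall i j (P : T -> T -> Prop), i != j ->
  p i [set s | p j [set t | P s t]] -> p j [set t | p i [set s | P s t]].

Definition state := I -> seq T.

Definition push (i : I) (t : T) (f : state) : state :=
  fun j => if j == i then rcons (f j) t else f j.

(* Adjoining letters along [w]: for p_(w_0)-almost all t_0, for
   p_(w_1)-almost all t_1, and so on. *)
Fixpoint iterated (w : seq I) (f : state) : set_system state :=
  if w is i :: w' then
    fun P => p i [set t | iterated w' (push i t f) P]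
  else fun P => P f.

Lemma push_comm i j s t f : i != j ->
  push i s (push j t f) = push j t (push i s f).
Proof.
move=> ij; apply/funext => k; rewrite /push.
by case: (eqVneq k i) => // ->; rewrite (negbTE ij).
Qed.

Global Instance iterated_filter w f : ProperFilter (iterated w f).
Proof.
elim: w f => [|i w IH] f.
  by apply: Build_ProperFilter_ex => [P Pf|]; [exists f|split=> // P Q PQ /PQ].
apply: Build_ProperFilter_ex.
  move=> P /= /filter_ex[t]; exact: filter_ex.
split=> /=.
- by apply: filterE => t; exact: filterT.
- by move=> P Q; apply: filterS2 => t; exact: filterI.
- by move=> P Q PQ; apply: filterS => t; exact: filterS.
Qed.

Global Instance iterated_ultra w f : UltraFilter (iterated w f).
Proof.
apply: ultra_of_setVsetC => P; elim: w f => [|i w IH] f /=; first exact: EM.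
set S := [set t | iterated w (push i t f) P].
have [/= pS|pS] := in_ultra_setVsetC S (p_ultra i); [by left|right].
by apply: filterS pS => t; rewrite /S /=; case: (IH (push i t f)).
Qed.

Lemma iterated_cat w w' f P :
  iterated (w ++ w') f P = iterated w f [set g | iterated w' g P].
Proof. by elim: w f => //= i w IH f; congr (p i _); apply/funext => t /=. Qed.

Lemma iterated_swap i j w f P : iterated [:: i, j & w] f P ->
  iterated [:: j, i & w] f P.
Proof.
have [->//|ij /=] := eqVneq i j.
move=> /(p_comm ij); apply: filterS => t /=; apply: filterS => s /=.
by rewrite push_comm // eq_sym.
Qed.

(** Adjacent swaps carry the head of [w] to its position in [w']. This is how copies of a chosen [i]
    are moved to the front of a word. *)
Lemma iterated_perm w w' f P : perm_eq w w' ->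
  iterated w f P -> iterated w' f P.
Proof.
elim: w w' f P => [|i w IH] w' f P ww'.
  by move: ww'; rewrite perm_sym => /perm_nilP->.
have iw' : i \in w' by rewrite -(perm_mem ww') mem_head.
case: (path.splitPr iw') ww' => w1 w2 ww' iw {iw'}.
have {}ww' : perm_eq w (w1 ++ w2).
  by move: ww'; rewrite -(cat1s i w2) perm_sym perm_catCA /= perm_cons perm_sym.
have {IH iw} : iterated (i :: (w1 ++ w2)) f P.
  by move: iw => /=; apply: filterS => t; exact: IH.
elim: w1 f {ww'} => [//|j w1 IH] f /iterated_swap /=.
by apply: filterS => t; exact: IH.
Qed.

Lemma iterated_size w f :
  iterated w f [set g | forall i, size (g i) = (size (f i) + count_mem i w)%N].
Proof.
elim: w f => [|i w IH] f /=; first by move=> i; rewrite addn0.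
apply: filterE => t; apply: filterS (IH (push i t f)) => g /= gE j.
rewrite gE /push (eq_sym i); case: eqVneq => _; last by rewrite add0n.
by rewrite size_rcons addSnnS.
Qed.

Lemma iterated_take w f :
  iterated w f [set g | forall i, take (size (f i)) (g i) = f i].
Proof.
elim: w f => [|i w IH] f /=; first by move=> i; rewrite take_size.
apply: filterE => t; apply: filterS (IH (push i t f)) => g /= gE j.
move: (gE j); rewrite /push; case: ifP => // _ /(congr1 (take (size (f j)))).
by rewrite take_takel ?size_rcons // -cats1 take_size_cat.
Qed.

(** The first [i] in [w] determines the letter right after [f i]. It avoids [t] almost surely
    because [p i] is free, and later letters leave it in place. *)
Lemma iterated_letter i t w f : i \in w ->
  iterated w f [set g | take (size (f i)).+1 (g i) <> rcons (f i) t].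
Proof.
elim: w f => [//|j w IH] f iw /=.
have [ji|ij] := eqVneq j i.
  rewrite {}ji in iw *.
  have pt : p i (~` [set t]) by apply: ultra_setC; exact: p_free.
  apply: filterS pt => s st; apply: filterS (iterated_take w (push i s f)) => g /= gE.
  move: (gE i); rewrite /push eqxx size_rcons => -> /rcons_inj[].
  by move=> ts; apply: st.
move: iw; rewrite inE eq_sym (negbTE ij) /= => iw.
apply: filterE => s; move: (IH (push j s f) iw).
by rewrite /push eq_sym (negbTE ij).
Qed.

(* The only way to enter a cone from outside is to append one prescribed letter. *)
Lemma iterated_cone w f i x : take (size x) (f i) <> x ->
  iterated w f [set g | take (size x) (g i) <> x].
Proof.
move=> fx; have [xf|fltx] := leqP (size x) (size (f i)).
  apply: filterS (iterated_take w f) => g /= /(_ i) gE gx; apply: fx.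
  by rewrite -gE take_takel.
have [iw|iw] := boolP (i \in w); last first.
  apply: filterS (iterated_size w f) => g /= /(_ i) gE gx.
  move: gE; rewrite (count_memPn iw) addn0 => gE.
  have := congr1 size gx; rewrite size_take gE ltnNge (ltnW fltx) /= => sx.
  by rewrite sx ltnn in fltx.
case: x fx fltx => [//|t0 x] fx fltx; set y := t0 :: x in fx fltx *.
apply: filterS2 (iterated_take w f) (iterated_letter (nth t0 y (size (f i))) f iw).
move=> g /= /(_ i) gf + gy; apply.
rewrite -{2}gf -(take_takel (g i) fltx) gy (take_nth t0) //.
by rewrite -gy take_takel // ltnW.
Qed.

Lemma iterated_cone_stable w f i x : take (size x) (f i) = x ->
  iterated w f [set g | take (size x) (g i) = x].
Proof.
move=> fx; apply: filterS (iterated_take w f) => g /= /(_ i) gf.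
by rewrite -[RHS]fx -gf take_takel // -[X in (size X <= _)%N]fx size_take geq_minr.
Qed.

(** At a coordinate [i] where the states differ, either [f] is outside the cone of [g i], which is
    then avoided, or [f i] properly extends [g i] and coordinates never shrink. *)
Lemma iterated_neq w f g : f <> g -> iterated w f (~` [set g]).
Proof.
move=> fg; have [i fgi] : exists i, f i <> g i.
  by apply: contrapT => /forallNP fg'; apply: fg; apply/funext => i; apply: contrapT.
have [gf|gf] := EM (take (size (g i)) (f i) = g i); last first.
  apply: filterS (iterated_cone w gf) => h /= + hg; apply.
  by rewrite hg take_size.
apply: filterS (iterated_take w f) => h /= /(_ i) + hg; rewrite hg => fg'.
apply: fgi; move: fg'; rewrite take_oversize //.
by rewrite -gf size_take geq_minr.
Qed.

(** * The tree topology *)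

Variable m : I -> nat.

Definition empty_state : state := fun=> [::].

(** [iterated full_word empty_state] is the ultrafilter u on the top level; by commutation the order
    of the word is immaterial. *)
Definition full_word : seq I := flatten [seq nseq (m i) i | i <- enum I].

(* The nodes of length j in coordinate i form a level of the i-th chain; all
   other states are isolated points, including the irrelevant ones that are
   neither nodes nor of full size [m] in every coordinate. *)
Definition node (i : I) (f : state) : Prop :=
  (forall j, j != i -> f j = [::]) /\ (0 < size (f i) < m i)%N.

(* Words leading from [empty_state] to the top level or to a level of chain i. *)
Definition level (i : I) (w : seq I) : Prop :=
  perm_eq w full_word \/ exists2 c, (c < m i)%N & perm_eq w (nseq c i).

Definition tree_open (O : set state) : Prop :=
  forall i f, node i f -> O f -> forall w,
    level i (nseq (size (f i)) i ++ w) -> iterated w f O.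

(** These are all the isolated states, incomplete ones such as [empty_state] included; u
    concentrates on the complete ones. *)
Definition tops : set state := [set f | forall i, ~ node i f].

Lemma count_full_word i : count_mem i full_word = m i.
Proof.
rewrite count_flatten -map_comp sumnE big_map big_enum /=.
rewrite (bigD1 i) //= count_nseq /= eqxx mul1n big1 ?addn0 // => j ji.
by rewrite count_nseq /= (negbTE ji).
Qed.

Lemma full_word_split i j : (j <= m i)%N ->
  exists w, perm_eq (nseq j i ++ w) full_word.
Proof.
move=> jm; exists (nseq (m i - j) i ++ [seq l <- full_word | predC1 i l]).
rewrite catA -nseqD subnKC // -{1}(count_full_word i).
have -> : nseq (count_mem i full_word) i = [seq l <- full_word | pred1 i l].
  by rewrite -size_filter; apply/esym/all_pred1P; exact: filter_all.
by rewrite perm_filterC.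
Qed.

Lemma node_ext i f g : node i f -> node i g -> f i = g i -> f = g.
Proof.
move=> [f0 _] [g0 _] fg; apply/funext => j.
by have [->//|ji] := eqVneq j i; rewrite f0 // g0.
Qed.

Lemma node_neq0 i f : node i f -> f i <> [::].
Proof. by move=> [_] /[swap] ->. Qed.

Lemma node_unique i j f : node i f -> f j <> [::] -> j = i.
Proof. by move=> [f0 _] fj; apply: contrapT => /eqP /f0. Qed.

Lemma iterated_node i j : (0 < j < m i)%N ->
  iterated (nseq j i) empty_state [set f | node i f /\ size (f i) = j].
Proof.
move=> ij; apply: filterS (iterated_size (nseq j i) empty_state) => f /= fE.
have fi : size (f i) = j by rewrite fE count_nseq /= eqxx mul1n.
split=> //; split=> [k ki|]; last by rewrite fi.
by apply: size0nil; rewrite fE count_nseq /= eq_sym (negbTE ki).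
Qed.

Lemma complete_top f : (forall i, size (f i) = m i) -> tops f.
Proof. by move=> fm i [_]; rewrite fm ltnn andbF. Qed.

Lemma iterated_tops : iterated full_word empty_state tops.
Proof.
apply: filterS (iterated_size full_word empty_state) => f /= fE; apply: complete_top.
by move=> i; rewrite fE count_full_word.
Qed.

Lemma tree_open_tops O : O `<=` tops -> tree_open O.
Proof. by move=> Otop i f nf /Otop /(_ i). Qed.

Lemma tree_open_setT : tree_open setT.
Proof. by move=> *; exact: filterT. Qed.

Lemma tree_open_setI : setI_closed tree_open.
Proof.
by move=> A B oA oB i f nf [Af Bf] w lw; apply: filterI; [exact: (oA i)|exact: (oB i)].
Qed.

Lemma tree_open_bigcup (J : Type) (A : J -> set state) :
  (forall j, tree_open (A j)) -> tree_open (\bigcup_j A j).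
Proof.
move=> oA i f nf [j _ Aj] w lw; apply: filterS (oA j i f nf Aj w lw) => g Ag.
by exists j.
Qed.

Lemma tree_open_cone i x : tree_open [set f | take (size x) (f i) = x].
Proof. by move=> j f _ fx w _; exact: iterated_cone_stable. Qed.

Lemma tree_open_coneC i x : tree_open [set f | take (size x) (f i) <> x].
Proof. by move=> j f _ fx w _; exact: iterated_cone. Qed.

Lemma tree_open_set1C f : tree_open (~` [set f]).
Proof. by move=> i g _ gf w _; exact: iterated_neq. Qed.

Lemma tree_hausdorff f g : f <> g ->
  exists U V, [/\ tree_open U, tree_open V, U f, V g & U `&` V = set0].
Proof.
(* Two nodes lying in each other's cones coincide, so after a swap [f] is outside the cone of [g]
   whenever [g] is a node. That cone is clopen and separates them. *)
wlog fg : f g / ~ (exists2 i, node i g & take (size (g i)) (f i) = g i).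
  move=> wl fg; have [[i ng gf]|] :=
    EM (exists2 i, node i g & take (size (g i)) (f i) = g i);
    last by move=> /wl; apply.
  have [|V [U [oV oU Vg Uf VU]]] := wl g f _ (nesym fg); last first.
    by exists U, V; rewrite setIC.
  move=> [j nf fg']; apply: fg.
  have fj0 := node_neq0 nf.
  have ji : j = i by apply: (node_unique ng) => gj; apply: fj0; rewrite -fg' gj.
  rewrite {}ji in nf fg' fj0; apply: (node_ext nf ng).
  move: fg'; rewrite take_oversize // -gf size_take.
  exact: geq_minr.
move=> neq; have [[i ng]|/forallNP ng] := EM (exists i, node i g).
  exists [set h | take (size (g i)) (h i) <> g i],
    [set h | take (size (g i)) (h i) = g i].
  split.
  - exact: tree_open_coneC.
  - exact: tree_open_cone.
  - by move=> gf; apply: fg; exists i.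
  - exact: take_size.
  - by apply/seteqP; split=> // h [].
exists (~` [set g]), [set g]; split=> //.
- exact: tree_open_set1C.
- by apply: tree_open_tops => _ ->.
- exact: setICl.
Qed.

(** From a node, the word that completes every coordinate to full size reaches only tops and stays
    in [O] almost surely. *)
Lemma tree_open_dense O f : tree_open O -> O f -> O `&` tops !=set0.
Proof.
move=> oO Of; have [[i nf]|/forallNP ng] := EM (exists i, node i f); last by exists f.
have [|w wM] := @full_word_split i (size (f i)).
  by case: nf => _ /andP[_ /ltnW].
have := oO i f nf Of w (or_introl wM).
move=> /(filterI (iterated_size w f)) /filter_ex[g [gE Og]].
exists g; split=> //; apply: complete_top => j.
rewrite gE -count_full_word -(permP wM) count_cat count_nseq /= (eq_sym i).
case: eqVneq => [->|ji]; first by rewrite mul1n.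
by case: nf => f0 _; rewrite f0.
Qed.

(** The iterated limit splits at level [j]: almost every node there lies in [O], and openness at
    that node accounts for [w]. *)
Lemma iterated_open i j w O : (0 < j < m i)%N -> tree_open O ->
  level i (nseq j i ++ w) -> iterated (nseq j i) empty_state O ->
  iterated (nseq j i ++ w) empty_state O.
Proof.
move=> ij oO lw vO; rewrite iterated_cat.
apply: filterS2 (iterated_node ij) vO => f [nf fj] Of.
by apply: (oO i) => //; rewrite fj.
Qed.

Lemma iterated_open_le i j k O : (0 < j <= k)%N -> (k < m i)%N -> tree_open O ->
  iterated (nseq j i) empty_state O -> iterated (nseq k i) empty_state O.
Proof.
move=> /andP[j0 jk] km oO vO; rewrite -(subnKC jk) nseqD.
apply: iterated_open => //; first by rewrite j0 (leq_ltn_trans jk).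
by right; exists k => //; rewrite -nseqD subnKC.
Qed.

(** [N] is the union of the cones over [B]. Moving [j] copies of [i] to the front of the full word
    shows that the length-[j] prefix is distributed as on level [j], so [N] is u-null because [B] is
    null there. *)
Lemma null_nodes i j B : (0 < j < m i)%N ->
  B `<=` [set f | node i f /\ size (f i) = j] -> ~ iterated (nseq j i) empty_state B ->
  exists N, [/\ tree_open N, B `<=` N & iterated full_word empty_state (~` N)].
Proof.
move=> ij Bn nB; exists [set g | exists2 b, B b & take j (g i) = b i]; split.
- move=> k f _ [b Bb fb] w _; have [_ bj] := Bn _ Bb; rewrite -bj in fb.
  apply: filterS (iterated_cone_stable w fb) => g /= gb.
  by exists b => //; rewrite -bj.
- by move=> b Bb; exists b => //; have [_ <-] := Bn _ Bb; rewrite take_size.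
have [|w wM] := @full_word_split i j; first by case/andP: ij => _ /ltnW.
apply: (iterated_perm wM); rewrite iterated_cat.
apply: filterS2 (iterated_node ij) (ultra_setC _ nB) => f [nf fj] nBf.
apply: filterS (iterated_take w f) => g /= /(_ i) gf [b Bb gb]; apply: nBf.
have [nb _] := Bn _ Bb; rewrite (node_ext nf nb) //.
by rewrite -gf fj.
Qed.

(** * Open filters on the tree given by final segments of the chains *)

(** In chain [i] the levels of length at most [k i] are discarded. The values from 0 (keep all) to
    [m i - 1] (keep only the top) are the elements of the i-th factor. *)
Definition level_filter (k : I -> nat) : set_system state :=
  [set P | iterated full_word empty_state P /\
    forall i j, (k i < j < m i)%N -> iterated (nseq j i) empty_state P].

Lemma level_filter_proper k : ProperFilter (level_filter k).
Proof.
apply: Build_ProperFilter_ex; first by move=> P [/filter_ex].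
split.
- by split=> *; exact: filterT.
- by move=> P Q [uP vP] [uQ vQ]; split=> *; apply: filterI => //; [exact: vP|exact: vQ].
- by move=> P Q PQ [uP vP]; split=> *; [exact: filterS uP|exact: filterS (vP _ _ _)].
Qed.

Lemma level_filter_le k k' : (forall i, (k i <= k' i)%N) ->
  level_filter k `<=` level_filter k'.
Proof.
move=> kk' P [uP vP]; split=> // i j /andP[kj jm]; apply: vP.
by rewrite jm (leq_ltn_trans (kk' i)).
Qed.

Lemma level_filter_le_inv k k' i : (k i < m i)%N ->
  level_filter k `<=` level_filter k' -> (k i <= k' i)%N.
Proof.
move=> km kk'; rewrite leqNgt; apply/negP => k'k.
have ki : (0 < k i < m i)%N by rewrite km (leq_ltn_trans _ k'k).
(* The test set omits level [k i] of chain [i]: this level is discarded by [k] but retained by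
   [k']. *)
have [] := kk' (~` [set f | node i f /\ size (f i) = k i]).
  split; first by apply: filterS iterated_tops => f /(_ i) nf [].
  move=> j c /andP[kc cm].
  apply: filterS (@iterated_node j c _) => [f [nf fc] [nf' fk]|].
    have ij : i = j by apply: node_unique nf _; exact: node_neq0 nf'.
    by move: kc; rewrite -fc -ij fk ltnn.
  by rewrite cm (leq_ltn_trans _ kc).
move=> _ /(_ i (k i)); rewrite k'k km => /(_ isT); apply: filter_setC.
exact: iterated_node.
Qed.

Lemma level_filter_free k f : full_word != [::] ->
  exists U, [/\ tree_open U, U f & level_filter k (~` U)].
Proof.
(* One neighborhood avoided along all nonempty words serves every level and the top at once. *)
move=> M0; suff [U [oU Uf wU]] : exists U, [/\ tree_open U, U f &
    forall w, w != [::] -> iterated w empty_state (~` U)].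
  exists U; split=> //; split; first exact: wU.
  by move=> i [|j]; rewrite ?ltn0 // => _; exact: wU.
have [[i nf]|/forallNP ng] := EM (exists i, node i f).
  exists [set g | take (size (f i)) (g i) = f i]; split.
  - exact: tree_open_cone.
  - exact: take_size.
  - by move=> w _; apply: iterated_cone => /esym; exact: node_neq0.
exists [set f]; split=> //; first by apply: tree_open_tops => _ ->.
move=> w w0; have [<-|] := EM (empty_state = f); last exact: iterated_neq.
case: w w0 => // i w _; apply: filterS (iterated_size (i :: w) empty_state) => g /= gE gr.
by have := gE i; rewrite gr /= eqxx.
Qed.

Lemma level_size i w : level i w -> (size w <= size full_word)%N.
Proof.
case=> [/perm_size->//|[c cm /perm_size->]]; rewrite size_nseq.
by apply: leq_trans (ltnW cm) _; rewrite -(count_full_word i) count_size.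
Qed.

(** There are only finitely many words of bounded length over a finite alphabet. *)
Lemma filter_words (F : set_system state) N (L : seq I -> Prop)
    (Q : seq I -> set state) : Filter F ->
  (forall w, L w -> (size w <= N)%N) -> (forall w, L w -> F (Q w)) ->
  F [set g | forall w, L w -> Q w g].
Proof.
move=> FF LN FQ.
have : F [set g | forall w : N.-bseq I, L w -> Q w g].
  apply: (@filter_forall _ _ (fun w : N.-bseq I => [set g | L w -> Q w g])) => w.
  have [Lw|nLw] := EM (L w); last by apply: filterE => g /= /nLw.
  by apply: filterS (FQ _ Lw) => g Qg _.
by apply: filterS => g Qg w Lw; exact: (Qg (Bseq (LN _ Lw))).
Qed.

Lemma level_filter_level k P i j w : (k i < j)%N ->
  level i (nseq j i ++ w) -> level_filter k P ->
  iterated (nseq j i ++ w) empty_state P.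
Proof.
move=> kj lw [uP vP]; case: lw => [wM|[c cm wc]].
  by apply: iterated_perm uP; rewrite perm_sym.
apply: (@iterated_perm (nseq c i)); first by rewrite perm_sym.
apply: vP; rewrite cm andbT (leq_trans kj) //.
by rewrite -(size_nseq c i) -(perm_size wc) size_cat size_nseq leq_addr.
Qed.

(** From [P] remove the nodes on discarded levels and those from which [P] fails to be large along
    some admissible word. Being large along [w ++ w'] from [f] means being large along [w'] from
    almost every state that [w] reaches, so what remains is open. *)
Lemma level_filter_open k P : level_filter k P ->
  exists O, [/\ tree_open O, level_filter k O & O `<=` P].
Proof.
move=> kP; have [uP vP] := kP.
exists (P `&` [set f | forall i, node i f -> (k i < size (f i))%N /\
  forall w, level i (nseq (size (f i)) i ++ w) -> iterated w f P]).
split; last by move=> f [].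
- move=> i f nf [Pf /(_ i nf)[kf Of]] w lw; apply: filterI; first exact: Of.
  have fi0 : (0 < size (f i))%N by case: nf => _ /andP[].
  have node_i g j : (forall l, size (g l) = (size (f l) + count_mem l w)%N) ->
      node j g -> j = i.
    move=> gE nj; apply/esym/(node_unique nj) => /(congr1 size).
    by rewrite gE; case: (size (f i)) fi0.
  (* A word with a letter other than [i] leads from [f] to states that are not nodes, where the
     second condition is vacuous. *)
  have [wi|] := boolP (all (pred1 i) w); last first.
    move=> /allPn[l lw' /= li]; apply: filterS (iterated_size w f) => g /= gE j ng.
    have ji := node_i _ _ gE ng; rewrite {}ji in ng.
    case: ng => /(_ _ li) /(congr1 size); rewrite gE /=.
    move: lw'; rewrite -has_pred1 has_count => c0 /eqP.
    by rewrite addn_eq0 (gtn_eqF c0) andbF.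
  have wS : nseq (size (f i) + size w) i = nseq (size (f i)) i ++ w.
    by rewrite nseqD -(all_pred1P _ _ wi).
  have FW : iterated w f [set g | forall w',
      level i (nseq (size (f i) + size w) i ++ w') -> iterated w' g P].
    apply: (@filter_words _ (size full_word)) => w'.
      by move=> /level_size; rewrite size_cat; apply: leq_trans; exact: leq_addl.
    by rewrite wS -catA => /Of; rewrite iterated_cat.
  apply: filterS2 (iterated_size w f) FW => g gE gP j ng.
  have ji := node_i _ _ gE ng; rewrite {}ji in ng *.
  have -> : size (g i) = (size (f i) + size w)%N.
    by rewrite gE; congr addn; apply/eqP; rewrite -all_count.
  by split => //; exact: (leq_trans kf (leq_addr _ _)).
- split=> [|i j /andP[kj jm]].
    by apply: filterI => //; apply: filterS iterated_tops => f tf i /(tf i).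
  have ij : (0 < j < m i)%N by rewrite jm (leq_ltn_trans _ kj).
  apply: filterI; first by apply: vP; rewrite kj.
  have FW : iterated (nseq j i) empty_state [set g | forall w',
      level i (nseq j i ++ w') -> iterated w' g P].
    apply: (@filter_words _ (size full_word)) => w'.
      by move=> /level_size; rewrite size_cat; apply: leq_trans; exact: leq_addl.
    by move=> lw'; have := level_filter_level kj lw' kP; rewrite iterated_cat.
  apply: filterS2 (iterated_node ij) FW => g [ng gj] gP l ng'.
  have li : l = i by apply: (node_unique ng); exact: node_neq0 ng'.
  by rewrite li gj.
Qed.

Hypothesis m_gt0 : forall i, (0 < m i)%N.

(** On each level [G] traces either nothing or exactly the prescribed ultrafilter, and the levels
    with empty trace form an initial segment of each chain; [k i] is the last of them. *)
Lemma level_filter_classify (G : set_system state) : ProperFilter G ->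
  (forall A, G A -> exists O, [/\ tree_open O, G O & O `<=` A]) ->
  (forall V, iterated full_word empty_state V -> G (V `|` ~` tops)) ->
  exists2 k, (forall i, (k i < m i)%N) & G = level_filter k.
Proof.
move=> GF Gopen Gtop.
pose S i j := [set f | node i f /\ size (f i) = j].
have GS i j V : (0 < j < m i)%N -> iterated (nseq j i) empty_state V ->
    G (V `|` ~` S i j).
  move=> ij vV.
  have nB : ~ iterated (nseq j i) empty_state (S i j `\` V).
    by move=> /(filterI vV) /filter_ex[f [Vf []]].
  (* An open member of [G] whose tops avoid the open set [N] avoids [N] altogether, since the tops
     are dense. *)
  have [N [oN BN uN]] := null_nodes ij (@subDsetl _ _ _) nB.
  have [O [oO GO ON]] := Gopen _ (Gtop _ uN).
  apply: filterS GO => f Of; apply: contrapT => /not_orP[nVf /contrapT Sf].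
  have Nf : N f by apply: BN.
  have [g [[Og Ng] tg]] := tree_open_dense (tree_open_setI oO oN) (conj Of Nf).
  by case: (ON _ Og).
have Gu O : tree_open O -> G O -> iterated full_word empty_state O.
  move=> oO GO; apply: contrapT => /ultra_setC /Gtop /(filterI GO) nO.
  have [O' [oO' GO' O'O]] := Gopen _ nO.
  have [f O'f] := filter_ex GO'.
  have [g [/O'O[Og [//|ntg]] tg]] := tree_open_dense oO' O'f.
  exact: ntg.
have Gv i j O : (0 < j < m i)%N -> ~ G (~` S i j) -> tree_open O -> G O ->
    iterated (nseq j i) empty_state O.
  move=> ij nS oO GO; apply: contrapT => /ultra_setC nO; apply: nS.
  apply: filterS (filterI GO (GS i j _ ij nO)) => f [Of [//|]]; exact.
(* An open member of [G] missing level [k] cannot be large on an earlier level [j], as it would then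
   be large on level [k]. *)
have GSle i j k : (0 < j <= k)%N -> (k < m i)%N -> G (~` S i k) -> G (~` S i j).
  move=> /andP[j0 jk] km Sk; apply: contrapT => Sj.
  have [O [oO GO Ok]] := Gopen _ Sk.
  have ij : (0 < j < m i)%N by rewrite j0 (leq_ltn_trans jk).
  have ik : (0 < k < m i)%N by rewrite km (leq_trans j0).
  have jk' : (0 < j <= k)%N by rewrite j0.
  have vO := iterated_open_le jk' km oO (Gv _ _ _ ij Sj oO GO).
  by have [f [Sf /Ok]] := filter_ex (filterI (iterated_node ik) vO).
(* The maximum exists: 0 always qualifies, because no node has length 0 and [m i] is positive. *)
have /choice[k kP] i : exists c, [/\ (c < m i)%N, G (~` S i c) &
    forall j, (j < m i)%N -> G (~` S i j) -> (j <= c)%N].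
  have S0 : exists c, (c < m i)%N && `[< G (~` S i c) >].
    exists 0%N; rewrite m_gt0; apply/asboolP; apply: filterE => f [[_ /andP[+ _]]].
    by case: (size _).
  have Sm c : (c < m i)%N && `[< G (~` S i c) >] -> (c <= m i)%N by case/andP=> /ltnW.
  case: (ex_maxnP S0 Sm) => c /andP[cm /asboolP Sc] cmax; exists c; split=> // j jm Sj.
  by apply: cmax; rewrite jm; apply/asboolP.
exists k => [i|]; first by have [] := kP i.
apply/seteqP; split=> P GP.
  have [O [oO GO OP]] := Gopen _ GP; split; first by apply: filterS OP _; exact: Gu.
  move=> i j /andP[kj jm]; apply: filterS OP _; apply: Gv => //.
    by rewrite jm (leq_ltn_trans _ kj).
  by have [_ _ kmax] := kP i => /(kmax _ jm); rewrite leqNgt kj.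
have [uP vP] := GP.
have GS' : G [set f | forall i (j : 'I_(m i)), S i j f -> P f].
  apply: (@filter_forall _ _ (fun i => [set f | forall j : 'I_(m i), S i j f -> P f])).
  move=> i; apply: (@filter_forall _ _ (fun j : 'I_(m i) => [set f | S i j f -> P f])) => j.
  have [kj|jk] := ltnP (k i) j.
    have ij : (0 < j < m i)%N by rewrite ltn_ord (leq_ltn_trans _ kj).
    have kjm : (k i < j < m i)%N by rewrite kj ltn_ord.
    by apply: filterS (GS _ _ _ ij (vP _ _ kjm)) => f /= [|nS /nS].
  have [km Sk _] := kP i; have [j0|j0] := posnP j.
    by apply: filterE => f [[_ /andP[+ _]]] => /[swap] ->; rewrite j0.
  have jk' : (0 < j <= k i)%N by rewrite j0.
  by apply: filterS (GSle _ _ _ jk' km Sk) => f nS /nS.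
apply: filterS2 (Gtop _ uP) GS' => f [//|ntf] SP.
have [i nf] : exists i, node i f by apply: contrapT => /forallNP.
have jm : (size (f i) < m i)%N by case: nf => _ /andP[].
exact: (SP i (Ordinal jm)).
Qed.

End IteratedUltrafilters.

(** * Topological spaces from a family of open sets *)

Section TopologyOfOpenSets.
Variables (T : Type) (op : set_system T).

(* The proofs are arguments of the type so that the topological structure can
   be inferred from it. *)
Definition space_of_open (opT : op setT) (opI : setI_closed op)
  (opU : forall (J : Type) (f : J -> set T), (forall j, op (f j)) ->
    op (\bigcup_j f j)) : Type := T.

Variables (opT : op setT) (opI : setI_closed op).
Variable opU : forall (J : Type) (f : J -> set T), (forall j, op (f j)) ->
    op (\bigcup_j f j).

HB.instance Definition _ := gen_eqMixin (space_of_open opT opI opU).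
HB.instance Definition _ := gen_choiceMixin (space_of_open opT opI opU).
HB.instance Definition _ :=
  @isOpenTopological.Build (space_of_open opT opI opU) op opT opI opU.

End TopologyOfOpenSets.

(** * Absorbing all but one ultrafilter *)

Section Absorption.
Variables (Z : topologicalType) (E : set Z) (u : set_system Z).
Hypothesis Z_sep : forall x y : Z, x <> y ->
  exists U V, [/\ open U, open V, U x, V y & U `&` V = set0].
Hypothesis E_open : forall A : set Z, A `<=` E -> open A.
Hypothesis u_ultra : UltraFilter u.

Definition free_ultra : Type :=
  {y : set_system Z | UltraFilter y /\ forall z, ~ y [set z]}.

(* [Base] and [Twin] are two copies of [Z]. The twins are isolated, every free
   ultrafilter y on them converges to [Lim y], and so does y on the base when
   it is [attached]. *)
Inductive point : Type := Base of Z | Twin of Z | Lim of free_ultra.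

(** The last clause says that [y] converges to no point of [Z]; otherwise [Lim y] could not be
    separated from that limit. *)
Definition attached (y : set_system Z) : Prop :=
  [/\ y E, y <> u & forall z, exists N, [/\ open N, N z & ~ y N]].

Definition absorption_open (O : set point) : Prop :=
  open (Base @^-1` O) /\ forall y : free_ultra, O (Lim y) ->
    sval y (Twin @^-1` O) /\ (attached (sval y) -> sval y (Base @^-1` O)).

Lemma absorption_openT : absorption_open setT.
Proof.
split=> [|[y [yU _]] _] /=; first exact: openT.
by split=> [|_]; exact: filterT.
Qed.

Lemma absorption_openI : setI_closed absorption_open.
Proof.
move=> A B [oA yA] [oB yB]; split=> [|y [/yA[TA BA] /yB[TB BB]]].
  exact: openI.
have [yU _] := svalP y.
by split=> [|ay]; apply: filterI => //; [exact: BA|exact: BB].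
Qed.

Lemma absorption_open_bigcup (J : Type) (A : J -> set point) :
  (forall j, absorption_open (A j)) -> absorption_open (\bigcup_j A j).
Proof.
move=> oA; split=> [|y [j _ Ajy]].
  rewrite preimage_bigcup; apply: bigcup_open => j _; exact: (oA j).1.
have [TA BA] := (oA j).2 y Ajy; have [yU _] := svalP y.
by split=> [|ay]; [apply: filterS TA|apply: filterS (BA ay)] => z Az; exists j.
Qed.

Definition absorption : topologicalType :=
  space_of_open absorption_openT absorption_openI absorption_open_bigcup.

Lemma open_base (U : set Z) : open U -> absorption_open (Base @` U).
Proof.
move=> oU; split=> [|y [//]]; suff -> : Base @^-1` (Base @` U) = U by [].
by apply/seteqP; split=> [z [z' Uz' [<-]]//|z Uz]; exists z.
Qed.

Lemma open_twin (z : Z) : absorption_open [set Twin z].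
Proof.
split=> [|//]; rewrite (_ : _ @^-1` _ = set0); first exact: open0.
by apply/seteqP; split.
Qed.

(** Cutting the base part down to [E] makes it open, and an attached [y] still contains it. *)
Definition limit_nbhd (y : free_ultra) (V : set Z) : set point :=
  fun x => match x with
  | Base z => E z /\ V z
  | Twin z => V z
  | Lim y' => y' = y
  end.

Lemma open_limit_nbhd y V : sval y V -> absorption_open (limit_nbhd y V).
Proof.
move=> yV; split=> [|_ ->]; first by apply: E_open => w [].
have [yU _] := svalP y.
by split=> // -[yE _ _]; exact: filterI.
Qed.

Lemma absorption_hausdorff : hausdorff_space absorption.
Proof.
suff sep (x y : point) : x <> y -> exists U V,
    [/\ absorption_open U, absorption_open V, U x, V y & U `&` V = set0].
  rewrite open_hausdorff => x y /eqP /sep[U [V [oU oV Ux Vy UV]]].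
  exists (U, V); first by split; exact/mem_set.
  by split=> //; apply/eqP.
(* The rank only serves to halve the case analysis by symmetry. *)
pose rank (x : point) := match x with Base _ => 0%N | Twin _ => 1%N | Lim _ => 2%N end.
wlog rxy : x y / (rank x <= rank y)%N.
  move=> wl xy; have [/wl|/ltnW /wl] := leqP (rank x) (rank y); first exact.
  move=> /(_ (nesym xy))[V [U [oV oU Vy Ux VU]]].
  by exists U, V; rewrite setIC.
case: x y rxy => [x|x|x] [y|y|y] // _ xy.
- have [|U [V [oU oV Ux Vy UV]]] := @Z_sep x y; first by move=> xy'; apply: xy; rewrite xy'.
  exists (Base @` U), (Base @` V); split; try exact: open_base; try exact: imageP.
  apply/seteqP; split=> // _ [[z Uz <-] [z' Vz' [zz']]].
  rewrite {}zz' in Vz'; have : (U `&` V) z by [].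
  by rewrite UV.
- exists (Base @` setT), [set Twin y]; split=> //.
  + by apply: open_base; exact: openT.
  + exact: open_twin.
  + by apply/seteqP; split=> // _ [[z _ <-]].
- have [yU _] := svalP y.
  have [N [oN Nx Ny]] : exists N, [/\ open N, N x & attached (sval y) -> ~ sval y N].
    have [[_ _ /(_ x)[N [? ? ?]]]|nay] := EM (attached (sval y)); first by exists N.
    by exists setT; split=> //; exact: openT.
  exists (Base @` N), (fun x' => match x' with
    | Base z => E z /\ ~ N z
    | Twin _ => True
    | Lim y' => y' = y
    end).
  split=> //; [exact: open_base| |].
    split=> [|_ ->]; first by apply: E_open => z [].
    split=> [|ay]; first exact: filterT.
    by apply: filterI; [case: ay|apply: ultra_setC => //; exact: Ny].
  by apply/seteqP; split=> // _ [[z Nz <-] []].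
- exists [set Twin x], [set Twin y]; split=> //.
  + exact: open_twin.
  + exact: open_twin.
  + by apply/seteqP; split=> // _ [-> /=].
- exists [set Twin x], (~` [set Twin x]); split=> //.
  + exact: open_twin.
  + have [yU yx] := svalP y; split=> [|z _].
      by rewrite (_ : _ @^-1` _ = setT); [exact: openT|apply/seteqP; split].
    have [zU zx] := svalP z; split=> [|_]; last by apply: filterE.
    by apply: filterS (ultra_setC zU (zx x)) => w /= wx [].
  + exact: setICr.
- have [xU _] := svalP x; have [yU _] := svalP y.
  have [V xV yV] : exists2 V, sval x V & sval y (~` V).
    apply: ultra_neq => xy'; apply: xy; congr Lim.
    by apply: eq_sig_hprop => // ? ? ?; exact: Prop_irrelevance.
  exists (limit_nbhd x V), (limit_nbhd y (~` V)); split=> //; try exact: open_limit_nbhd.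
  by apply/seteqP; split=> // -[z [[_ Vz] [_]]|z []|z [-> /= xy']] //; case: xy; rewrite xy'.
Qed.

Lemma absorption_infinite : infinite_set [set: Z] -> infinite_set [set: absorption].
Proof.
move=> Zinf Xfin; apply: Zinf.
have -> : [set: Z] = Base @^-1` setT by [].
apply: finite_preimage; last exact: Xfin.
by move=> x y _ _ [].
Qed.

(** * Free open filters on the absorption *)

Definition lift (G : set_system Z) : set_system point :=
  [set P | G (Base @^-1` P)].

Lemma liftE (G : set_system Z) P : lift G P = G (Base @^-1` P).
Proof. by []. Qed.

Lemma lift_inj G G' : lift G `<=` lift G' -> G `<=` G'.
Proof.
move=> GG' P GP; have E' : Base @^-1` (Base @` P) = P.
  by apply/seteqP; split=> [z [z' Pz' [<-]]//|z Pz]; exists z.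
by rewrite -E'; apply: GG'; rewrite /lift /= E'.
Qed.

(** The last clause says that no ultrafilter other than [u] contains both [G] and [E]. *)
Definition residual (G : set_system Z) : Prop :=
  [/\ ProperFilter G, open_filter G, free_filter G &
      forall V, u V -> G (V `|` ~` E)].

(** The delicate points are [Lim y]. If [y] is not attached, a neighborhood without base points
    exists; if it is, [y] differs from [u], and a set separating the two gives a neighborhood whose
    complement is in the lift. *)
Lemma lift_residual (G : set_system Z) : residual G ->
  [/\ ProperFilter (lift G), @open_filter absorption (lift G)
    & @free_filter absorption (lift G)].
Proof.
move=> [GF Gopen Gfree Gu]; split.
- apply: Build_ProperFilter_ex => P GP.
  by have [z Pz] := @filter_ex _ G _ _ GP; exists (Base z).
- move=> P /Gopen[U [oU GU UP]]; exists (Base @` U); split.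
  + exact: open_base.
  + by rewrite liftE; apply: filterS GU => z Uz; exists z.
  + by move=> _ [z /UP Pz <-].
case=> [z|z|y].
- have [U [oU Uz GU]] := Gfree z; exists (Base @` U); split.
  + exact: open_base.
  + by exists z.
  + by rewrite liftE; apply: filterS GU => w Uw [w' Uw' [ww']]; apply: Uw; rewrite -ww'.
- exists [set Twin z]; split=> //; first exact: open_twin.
  by rewrite liftE; apply: filterE => w [].
have [yU _] := svalP y.
have [ay|nay] := EM (attached (sval y)); last first.
  pose O : set point :=
    fun x => match x with Base _ => False | Twin _ => True | Lim y' => y' = y end.
  have oO : absorption_open O.
    split=> [|_ ->]; first exact: open0.
    by split=> [|/nay]; first exact: filterT.
  by exists O; split=> //; rewrite liftE; apply: filterE => z.
have [yE yu _] := ay.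
have [V yV uV] : exists2 V, sval y V & u (~` V).
  exact: ultra_neq.
exists (limit_nbhd y V); split=> //; first exact: open_limit_nbhd.
by rewrite liftE; apply: filterS (Gu _ uV) => w [nVw [_ Vw]|nEw [Ew _]].
Qed.

Lemma lift_surj (F : set_system absorption) :
  ProperFilter F -> open_filter F -> free_filter F ->
  exists2 G, residual G & F = lift G.
Proof.
move=> FF Fopen Ffree.
(* Otherwise [F] extends to an ultrafilter on the twins; it is free because [F] is, and it converges
   to a [Lim] point, against the freeness of [F] there. *)
have FTwin : F (~` range Twin).
  apply: contrapT; rewrite -[X in ~ F X]setCK setCK => nF.
  have [y [yU Fy yT]] := ultra_extension FF nF.
  have TU : UltraFilter [set A : set Z | y (Twin @` A)].
    by apply: ultra_inverse_image => // a b [].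
  have Tfree z : ~ y (Twin @` [set z]).
    have [U [_ Uz /Fy FU]] := Ffree (Twin z); move=> /(filterI FU) /filter_ex.
    by move=> [x [nU [_ -> zE]]]; apply: nU; rewrite -zE.
  have [U [oU Uy /Fy FU]] := Ffree (Lim (exist _ _ (conj TU Tfree))).
  have [/= yTU _] := oU.2 _ Uy.
  by have [x [nU [z Uz zE]]] := filter_ex (filterI FU yTU); apply: nU; rewrite -zE.
(* An open set without twins contains no [Lim] point either. *)
have FBase : F (range Base).
  have [O [oO FO OT]] := Fopen _ FTwin; apply: filterS FO.
  case=> [z _|z /OT|y Oy]; [by exists z|by case; exists z|].
  have [yU _] := svalP y; have [/filter_ex[z Oz] _] := oO.2 y Oy.
  by case: (OT _ Oz); exists z.
pose G := [set P | F (Base @` P)].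
have FG A : F A -> G (Base @^-1` A).
  by move=> FA; apply: filterS2 FBase FA => _ [z _ <-] Az; exists z.
have GF : ProperFilter G.
  split; first by rewrite /G /= image_set0; exact: filter_not_empty.
  split=> [//|A B|A B AB]; rewrite /G /=; last first.
    by apply: filterS => _ [x /AB Bx <-]; exists x.
  apply: filterS2 => _ [x Ax <-] [x' Bx' [xx']].
  by rewrite {}xx' in Bx'; exists x.
have Gfree : free_filter G.
  move=> z; have [U [oU Uz /FG FU]] := Ffree (Base z).
  by exists (Base @^-1` U); split=> //; exact: oU.1.
exists G; last first.
  apply/seteqP; split=> A; first exact: FG.
  by rewrite liftE /G /=; apply: filterS => _ [z Az <-].
split=> //.
- move=> P /Fopen[O [oO FO OP]]; exists (Base @^-1` O); split.
  + exact: oO.1.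
  + exact: FG.
  + by move=> z /OP[w Pw [<-]].
(* If the clause fails at [V], some ultrafilter extends [G] and contains [E] minus [V]. It differs
   from [u] and is attached, so freeness of [F] fails at its [Lim] point. *)
move=> V uV; apply: contrapT => nG.
have [|y [yU Gy yV]] := @ultra_extension _ G (E `\` V) _.
  by move=> GV; apply: nG; rewrite -[V]setCK setUC -setCI -setDE.
have yfree z : exists N, [/\ open N, N z & ~ y N].
  have [U [oU Uz /Gy yU']] := Gfree z; exists U; split=> // yN.
  exact: filter_setC yU'.
have yz z : ~ y [set z].
  have [N [_ Nz nyN]] := yfree z; apply: contra_not nyN.
  by apply: filterS => _ ->.
have ay : attached y.
  split=> //; first by apply: filterS yV => z [].
  move=> yu; have yV' : y V by rewrite yu.
  by have [z [Vz []]] := filter_ex (filterI yV' yV).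
have [U [oU Uy /FG /Gy yU']] := Ffree (Lim (exist _ _ (conj yU yz))).
have [_ /(_ ay) yBU] := oU.2 _ Uy.
by have [z [Uz nUz]] := filter_ex (filterI yBU yU').
Qed.

Lemma absorption_isomorphic (K : Type) (leK : K -> K -> Prop)
    (G : K -> set_system Z) :
  (forall k, residual (G k)) ->
  (forall H, residual H -> exists k, H = G k) ->
  (forall k k', leK k k' <-> G k `<=` G k') ->
  (forall k k', leK k k' -> leK k' k -> k = k') ->
  order_isomorphic (@OF_le absorption) leK.
Proof.
move=> Gres Gsurj Gle leK_anti.
have /choice[f fE] (F : OF absorption) : exists k, sval F = lift (G k).
  case: F => F /= [FF Fo Ff]; have [H Hres ->] := lift_surj FF Fo Ff.
  by have [k ->] := Gsurj _ Hres; exists k.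
have le_lift k k' : lift (G k) `<=` lift (G k') <-> leK k k'.
  by rewrite Gle; split=> [/lift_inj//|kk' P]; exact: kk'.
exists f; split; last by move=> F F'; rewrite /OF_le !fE.
exists (fun k => exist _ (lift (G k)) (lift_residual (Gres k))) => [F|k].
  by apply: eq_sig_hprop => [? ? ?|]; [exact: Prop_irrelevance|rewrite /= fE].
by apply: leK_anti; apply/le_lift; rewrite -fE.
Qed.

End Absorption.

(** * Commuting ultrafilters from measurable cardinals *)

Local Open Scope card_scope.

Lemma cardinal_complete_bigcap (K J T : Type) (F : set_system T) (B : J -> set T) :
  cardinal_complete K F -> card_lt [set: J] [set: K] -> (forall j, F (B j)) ->
  F (\bigcap_j B j).
Proof.
move=> Fcomplete [JK JneqK] FB; rewrite -[X in F X]/(\bigcap_(j in setT) B j).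
rewrite -(bigcap_image setT B idfun); apply: Fcomplete; first by move=> _ [j _ <-].
have BJ : B @` setT #<= [set: J] by exact: card_image_le.
split; first exact: card_le_trans BJ JK.
apply/negP => BK; move/negP: JneqK; apply; rewrite card_eq_le JK /=.
by apply: card_le_trans BJ; move: BK; rewrite card_eq_le => /andP[].
Qed.

Lemma card_lt_nat (K : Type) : ~ countable [set: K] ->
  card_lt [set: nat] [set: K].
Proof.
move=> Kunc; split.
  by apply/infiniteP => /finite_set_countable.
by apply/negP; rewrite card_eq_le => /andP[_].
Qed.

Lemma nat_free_ultrafilter : exists2 F : set_system nat,
  UltraFilter F & forall k, ~ F [set k].
Proof.
have [F [FU sF]] := ultraFilterLemma eventually_filter; exists F => // k Fk.
have : F [set j | (k < j)%N] by apply: sF; exists k.+1.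
by move=> /(filterI Fk) /filter_ex[_ [-> /=]]; rewrite ltnn.
Qed.

Section Letters.
Variables (n : nat) (kappa : nat -> Type).
Hypothesis kappa_measurable :
  forall i : nat, (1 <= i <= n.-1)%N -> measurable_cardinal (kappa i).
Hypothesis kappa_increasing : forall i j : nat, (1 <= i)%N -> (i < j)%N ->
  (j <= n.-1)%N -> card_lt [set: kappa i] [set: kappa j].

(* The role of the missing cardinal kappa_0 is played by [nat]. *)
Definition scale (i : nat) : Type := if i is 0 then nat else kappa i.

(** The disjoint union lets all the ultrafilters live on one type. *)
Definition letter : Type := {i : nat & scale i}.

Lemma letter_ultrafilter (i : 'I_n) : exists p : set_system letter,
  [/\ UltraFilter p, forall t, ~ p [set t], p [set t : letter | tag t = i :> nat] &
    forall j, (j < i)%N -> forall B : scale j -> set letter,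
      (forall x, p (B x)) -> p (\bigcap_x B x)].
Proof.
have [F [FU Ffree Fcomplete]] : exists F : set_system (scale i),
  [/\ UltraFilter F, forall x, ~ F [set x] &
    forall j, (j < i)%N -> forall B : scale j -> set (scale i),
      (forall x, F (B x)) -> F (\bigcap_x B x)].
  case: i => -[|i] /= ilt.
    by have [F FU Ffree] := nat_free_ultrafilter; exists F.
  have iltp : (1 <= i.+1 <= n.-1)%N by rewrite /= -ltnS (leq_trans ilt) // leqSpred.
  have [Kunc [F [FU Fnp Fcomplete]]] := kappa_measurable iltp.
  exists F; split=> //.
    move=> x Fx; apply: (Fnp x); apply/esym.
    apply: (max_filter (principal_filter_proper x)) => A FA.
    apply/principal_filterP.
    by have [_ [-> Ax]] := filter_ex (filterI Fx FA).
  move=> [|j] ji B; apply: cardinal_complete_bigcap Fcomplete _.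
    exact: card_lt_nat.
  exact: kappa_increasing.
exists (fmap (existT scale i) F); split.
- by apply: ultra_of_setVsetC => A;
  exact: (in_ultra_setVsetC (existT scale i @^-1` A) FU).
- move=> [j y] /= FS; have [x xy] := filter_ex FS.
  apply: (Ffree x); apply: filterS FS => z /= zy.
  move: zy; rewrite -xy => /(congr1 (tagged_as (existT scale i x))).
  by rewrite !tagged_asE.
- by rewrite /fmap /=; apply: filterE => x.
- move=> j ji B FB; rewrite /fmap /=.
  have := Fcomplete j ji (fun y => [set x | B y (existT scale i x)]) FB.
  by apply: filterS.
Qed.

(** For [i < j], completeness of [p j] over [scale i] makes almost every [t] typical for all [s]
    simultaneously. The case [j < i] follows by applying this to the negated relation. *)
Lemma letter_ultrafilters : exists p : 'I_n -> set_system letter,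
  [/\ forall i, UltraFilter (p i), forall i t, ~ p i [set t] &
    forall i j (P : letter -> letter -> Prop), i != j ->
      p i [set s | p j [set t | P s t]] -> p j [set t | p i [set s | P s t]]].
Proof.
have [p pP] := choice letter_ultrafilter; exists p.
have pU i : UltraFilter (p i) by case: (pP i).
have lt_comm (i j : 'I_n) (P : letter -> letter -> Prop) : (i < j)%N ->
    p i [set s | p j [set t | P s t]] -> p j [set t | p i [set s | P s t]].
  move=> ij piP; have [_ _ p_tag _] := pP i; have [_ _ _ complete] := pP j.
  (* [B x] collects the [t] that are typical for the letter [x]: what holds for almost all letters
     holds for [t]. *)
  pose B (x : scale i) := [set t | p j [set t | P (existT scale i x) t] ->
                                   P (existT scale i x) t].
  have pB x : p j (B x).
    have [pj|npj] := EM (p j [set t | P (existT scale i x) t]).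
      by apply: filterS pj => t Pt _.
    by apply: filterE => t /npj.
  apply: filterS (complete i ij B pB) => t Bt.
  apply: filterS2 piP p_tag => -[k x] /= pjP ki.
  by case: _ / (esym ki) x pjP => x pjP; exact: (Bt x I pjP).
split=> [//|i t|i j P]; first by case: (pP i).
rewrite neq_ltn => /orP[ij|ji]; first exact: lt_comm.
move=> piP; apply: contrapT => /ultra_setC npj.
have : p j [set t | p i [set s | ~ P s t]].
  by apply: filterS npj => t /ultra_setC.
move=> /(lt_comm _ _ (fun t s => ~ P s t) ji) npi.
have [s [Ps nPs]] := filter_ex (filterI piP npi).
exact: filter_setC Ps nPs.
Qed.

End Letters.

(** * Absorption applied to the tree space *)

Theorem theorem5p6 (n : nat) (n_gt0 : (0 < n)%N)
  (kappa : nat -> Type)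
  (kappa_measurable : forall i : nat, (1 <= i <= n.-1)%N ->
    measurable_cardinal (kappa i))
  (kappa_increasing : forall i j : nat, (1 <= i)%N -> (i < j)%N ->
    (j <= n.-1)%N -> card_lt [set: kappa i] [set: kappa j])
  (m : 'I_n -> nat) (m_gt0 : forall i : 'I_n, (0 < m i)%N) :
  exists X : topologicalType,
    [/\ hausdorff_space X, infinite_set [set: X]
      & order_isomorphic (@OF_le X) (@chain_prod_le n m)].
Proof.
have [p [p_ultra p_free p_comm]] := letter_ultrafilters kappa_measurable kappa_increasing.
pose Z : topologicalType := space_of_open (@tree_open_setT _ _ p p_ultra m)
  (@tree_open_setI _ _ p p_ultra m) (@tree_open_bigcup _ _ p p_ultra m).
(* For an empty word u would be principal at [empty_state]. *)
have M0 : full_word m != [::].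
  have := count_full_word m (Ordinal n_gt0).
  by case: full_word => //= m0; have := m_gt0 (Ordinal n_gt0); rewrite -m0.
pose G (k : chain_prod m) := level_filter p m (fun i => k i).
exists (@absorption Z (tops m) (iterated p (full_word m) (@empty_state _ _))).
split.
- apply: absorption_hausdorff.
  + by move=> f g fg; exact: tree_hausdorff.
  + by move=> A; exact: tree_open_tops.
- apply: absorption_infinite; apply/infiniteP.
  (* States of unbounded length, built from a single letter of [nat], already make the space
     infinite. *)
  pose f (k : nat) : Z := fun=> nseq k (existT (scale kappa) 0%N 0%N).
  have finj : injective f.
    by move=> k l /(congr1 (fun g => size (g (Ordinal n_gt0)))); rewrite !size_nseq.
  rewrite -(card_le_eql (inj_card_eq (A := setT) (in2W finj))).
  exact: card_leT.
have E_open (A : set Z) : A `<=` tops m -> open A by exact: tree_open_tops.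
apply: (absorption_isomorphic E_open (iterated_ultra p_ultra _ _) (G := G)).
- move=> k; split.
  + exact: level_filter_proper.
  + by move=> P kP; exact: level_filter_open.
  + by move=> f; exact: level_filter_free.
  + move=> V uV; split=> [|i j kj]; first by apply: filterS uV => f; left.
    have ij : (0 < j < m i)%N by case/andP: kj => /(leq_ltn_trans (leq0n _))->.
    by apply: filterS (iterated_node p_ultra ij) => f [nf _]; right=> /(_ i).
- move=> H [HF Hopen _ Hu].
  have [k km ->] := level_filter_classify p_ultra p_comm m_gt0 HF Hopen Hu.
  by exists (fun i => Ordinal (km i)).
- move=> k k'; split=> [kk'|kk' i]; first exact: level_filter_le.
  by apply: (level_filter_le_inv p_ultra _ kk').
- move=> k k' kk' k'k; apply: functional_extensionality_dep => i.
  by apply/val_inj/eqP; rewrite eqn_leq kk' k'k.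
Qed.
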